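(* Let $n\ge 1$ be an integer. For all vectors $\mathbf{z}=(z_1,\dots,z_n)$ with $0\le z_1\le z_2\le\cdots\le z_n\le 1$ and all $\alpha\in[0,0.5]$, $$m_\alpha(\mathbf{z})\le m_\alpha^{\text{Anderson}}(\mathbf{z}).$$
   Context: For vectors $\mathbf{z}=(z_1,\dots,z_n)$ with $0\le z_1\le\cdots\le z_n\le 1$ and $\mathbf{u}=(u_1,\dots,u_n)$ with $0\le u_1\le\cdots\le u_n\le 1$, define $$m(\mathbf{z},\mathbf{u})=1-\sum_{i=1}^n u_i(z_{i+1}-z_i),\qquad z_{n+1}:=1.$$ For a real random variable $Y$ with cumulative distribution function $F_Y$, the quantile function is $Q(1-\alpha,Y)=\inf\{y\in\mathbb{R}:F_Y(y)\ge 1-\alpha\}$. Let $\mathbf{U}=(U_1,\dots,U_n)$ be the order statistics (sorted increasingly) of $n$ independent samples from the continuous uniform distribution on $[0,1]$. For fixed $\mathbf{z}$ define $$m_\alpha(\mathbf{z})=Q(1-\alpha,\,m(\mathbf{z},\mathbf{U})),$$ where only $\mathbf{U}$ is random. Define $$m_\alpha^{\text{Anderson}}(\mathbf{z})=m(\mathbf{z},\mathbf{u}^{\text{DKW}}),\qquad \mathbf{u}^{\text{DKW}}_i=\max\left\{0,\ \frac{i}{n}-\sqrt{\frac{\ln(1/\alpha)}{2n}}\right\}\quad (1\le i\le n),$$ with the convention $\ln(1/0)=+\infty$ (so $\mathbf{u}^{\text{DKW}}=0$ when $\alpha=0$). *)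

(* Defs.v *)
From HB Require Import structures.
From mathcomp Require Import all_boot all_order all_algebra.
From mathcomp Require Import all_classical all_reals all_analysis.
From mathcomp Require Import measurable_realfun.

Set Implicit Arguments.
Unset Strict Implicit.
Unset Printing Implicit Defensive.

Import Order.TTheory GRing.Theory Num.Theory.
Import numFieldNormedType.Exports.

Local Open Scope classical_set_scope.
Local Open Scope ring_scope.

(* Indices are shifted to start at 0; the default value 1 of [nth], reached
   at i.+1 = n, encodes the convention z_(n+1) := 1. *)
Definition m_fun (R : realType) (n : nat) (z u : n.-tuple R) : R :=
  1 - \sum_(i < n) tnth u i * (nth 1 z i.+1 - nth 1 z i).

Definition order_statistics (R : realType) (n : nat) (x : 'I_n -> R) :
    n.-tuple R :=
  [tuple of sort <=%R [tuple x i | i < n]].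

Lemma order_statistics_le (R : realType) (n : nat) (x : 'I_n -> R) (k : 'I_n)
    (y : R) :
  (tnth (order_statistics x) k <= y) = (k < #|[pred i | x i <= y]%R|)%N.
Proof.
set s := order_statistics x.
have ss : sorted <=%R s by apply: sort_sorted => a b; exact: le_total.
have -> : #|[pred i | x i <= y]%R| = count (<= y) s.
  have /permP -> : perm_eq s [tuple x i | i < n] by rewrite perm_sort.
  by rewrite /= count_map -size_filter cardE enumT.
rewrite (tnth_nth 0); apply/idP/idP; last by move=> ?; exact: nth_count_le.
apply: contraTT; rewrite -leqNgt => kc; rewrite -ltNge.
by apply: nth_count_gt => //; rewrite kc size_tuple ltn_ord.
Qed.

Section m_sample.
Context d (T : measurableType d) (R : realType) (P : probability T R) (n : nat).
Variables (z : n.-tuple R) (X : 'I_n -> {RV P >-> R}).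

Lemma measurable_order_statistics (k : 'I_n) :
  measurable_fun setT (fun w => tnth (order_statistics (X ^~ w)) k).
Proof.
apply: (measurability _ (RGenOInfty.measurableE R)) => _ [_ [y ->] <-].
rewrite setTI -[X in measurable X]setCK; apply: measurableC.
rewrite [X in measurable X](_ : _ =
    \bigcup_(J in [set J : {set 'I_n} | (k < #|J|)%N])
      \bigcap_(i in [set` J]) X i @^-1` `]-oo, y]).
  apply: fin_bigcup_measurable => [|J _]; first exact: finite_finset.
  apply: fin_bigcap_measurable => [|i _]; first exact: finite_finset.
  by rewrite -[X in measurable X]setTI; exact: measurable_funP.
have E w : (~ `]y, +oo[%classic (tnth (order_statistics (X ^~ w)) k)) <->
    (k < #|[pred i | X i w <= y]%R|)%N.
  by rewrite /= in_itv/= andbT -order_statistics_le leNgt; split=> /negP.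
apply/seteqP; split=> w; first (move/E => kc).
  exists [set i | X i w <= y]%SET => /=; first by rewrite cardsE.
  by move=> i /=; rewrite inE in_itv.
case=> J /= kJ JX; apply/E; apply: (leq_trans kJ); apply/subset_leq_card.
apply/fintype.subsetP => i iJ.
by have := JX i iJ; rewrite /= in_itv inE.
Qed.

Definition m_sample (w : T) : R := m_fun z (order_statistics (X ^~ w)).

Lemma measurable_m_sample : measurable_fun setT m_sample.
Proof.
apply: measurable_funB => //; apply: measurable_sum => i.
by apply: measurable_funM => //; exact: measurable_order_statistics.
Qed.

HB.instance Definition _ :=
  isMeasurableFun.Build _ _ _ _ m_sample measurable_m_sample.

End m_sample.

Definition mutually_independent d (T : measurableType d) (R : realType)
    (P : probability T R) (n : nat) (X : 'I_n -> {RV P >-> R}) : Prop :=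
  forall (J : {set 'I_n}) (A : 'I_n -> set R),
    (forall i, i \in J -> measurable (A i)) ->
    (P (\bigcap_(i in [set` J]) X i @^-1` A i) =
     \prod_(i in J) P (X i @^-1` A i))%E.

Definition uniform_sample d (T : measurableType d) (R : realType)
    (P : probability T R) (n : nat) (X : 'I_n -> {RV P >-> R}) : Prop :=
  mutually_independent X /\
  forall i (A : set R), measurable A ->
    distribution P (X i) A = uniform_prob (@ltr01 R) A.

(* The infimum is taken in \bar R: +oo or -oo instead of the default value of
   [inf] on empty or unbounded sets. *)
Definition quantile d (T : measurableType d) (R : realType)
    (P : probability T R) (p : R) (Y : {RV P >-> R}) : \bar R :=
  ereal_inf [set y%:E | y in [set y : R | (p%:E <= cdf Y y)%E]].

Definition m_alpha d (T : measurableType d) (R : realType)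
    (P : probability T R) (n : nat) (X : 'I_n -> {RV P >-> R})
    (alpha : R) (z : n.-tuple R) : \bar R :=
  quantile (1 - alpha) (m_sample z X : {RV P >-> R}).

(* Since [ln 0 = 0] in the library, the convention ln (1 / 0) = +oo has to be
   spelled out. *)
Definition u_DKW (R : realType) (n : nat) (alpha : R) : n.-tuple R :=
  [tuple if alpha == 0 then 0 else
    Num.max 0 (i.+1%:R / n%:R - Num.sqrt (ln (1 / alpha) / (2 * n%:R)))
  | i < n].

Definition m_Anderson (R : realType) (n : nat) (alpha : R) (z : n.-tuple R) :
    R :=
  m_fun z (u_DKW n alpha).

(* Main.v *)
Require Import Defs.
From HB Require Import structures.
From mathcomp Require Import all_boot all_order all_algebra.
From mathcomp Require Import all_classical all_reals all_analysis.
From mathcomp Require Import ring lra.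

(* By monotonicity of m(z, .) it is enough to prove the one-sided
   Dvoretzky-Kiefer-Wolfowitz inequality: with probability at least 1 - alpha
   all the order statistics dominate u^DKW. Let N_t be the number of sample
   points below t. For every c > 0, (1 + c / t)^N_t is a martingale in
   decreasing t, with initial value (1 + c)^n at t = 1, so by Ville's inequality
   N_t >= n (t + e) happens for some t with probability at most
   (1 + c)^n / min_t (1 + c / t)^(n (t + e)), which is the Chernoff bound made
   uniform in t. The constant of Massart is recovered by choosing c so that
   (t + e) ln (1 + c / t) - ln (1 + c) >= 2 e^2 for all t in ]0, 1 - e]. *)

Set Implicit Arguments.
Unset Strict Implicit.
Unset Printing Implicit Defensive.

Import Order.TTheory GRing.Theory Num.Theory.
Import numFieldNormedType.Exports.

Local Open Scope classical_set_scope.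
Local Open Scope ring_scope.

(** * Inequalities between hyperbolic functions *)

Section real_inequalities.
Variable R : realType.
Implicit Types a b c e s t x y : R.

Lemma ge0_is_derive_le (f f' : R -> R) b : 0 <= b ->
  (forall x, 0 <= x <= b -> is_derive x 1 f (f' x)) ->
  (forall x, 0 <= x <= b -> 0 <= f' x) -> f 0 <= f b.
Proof.
move=> b0 df f'0.
have sub x : x \in `]0, b[ -> 0 <= x <= b.
  by rewrite in_itv/= => /andP[x0 xb]; rewrite !ltW.
apply: (@ger0_derive1_ndecr _ f 0 b) => //.
- by move=> x /sub xb; have [] := df _ xb.
- move=> x /sub xb; rewrite derive1E; have [_ ->] := df _ xb; exact: f'0.
- apply: derivable_within_continuous => x; rewrite in_itv/= => xb.
  by have [] := df _ xb.
Qed.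

Definition sinh x := (expR x - expR (- x)) / 2.
Definition cosh x := (expR x + expR (- x)) / 2.

Lemma is_derive_sinh x : is_derive x 1 sinh (cosh x).
Proof.
apply: is_derive_eq.
by rewrite /cosh /GRing.scale/=; lra.
Qed.

Lemma is_derive_cosh x : is_derive x 1 cosh (sinh x).
Proof.
apply: is_derive_eq.
by rewrite /sinh /GRing.scale/=; lra.
Qed.

Lemma sinhD x y : sinh (x + y) = sinh x * cosh y + cosh x * sinh y.
Proof. by rewrite /sinh /cosh opprD !expRD; field. Qed.

Lemma sinhB x y : sinh (x - y) = sinh x * cosh y - cosh x * sinh y.
Proof. by rewrite /sinh /cosh opprB !expRD; field. Qed.

Lemma cosh_ge1 x : 1 <= cosh x.
Proof.
by rewrite /cosh; have := expR_ge1Dx x; have := expR_ge1Dx (- x); lra.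
Qed.

Lemma sinh0 : sinh 0 = 0. Proof. by rewrite /sinh oppr0 subrr mul0r. Qed.

Lemma le_sinh x : 0 <= x -> x <= sinh x.
Proof.
move=> x0; rewrite -subr_ge0; have E : sinh 0 - 0 = 0 by rewrite sinh0 subr0.
rewrite -{1}E; apply: (@ge0_is_derive_le (fun y => sinh y - y)
  (fun y => cosh y - 1)) => // y _; last by rewrite subr_ge0 cosh_ge1.
by apply: is_deriveB; exact: is_derive_sinh.
Qed.

Lemma sinh_le_mul_cosh x : 0 <= x -> sinh x <= x * cosh x.
Proof.
move=> x0; rewrite -subr_ge0.
have E : 0 * cosh 0 - sinh 0 = 0 by rewrite sinh0 subr0 mul0r.
rewrite -{1}E; apply: (@ge0_is_derive_le (fun y => y * cosh y - sinh y)
  (fun y => y * sinh y)) => // y /andP[y0 _].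
  have dc := is_derive_cosh y; have ds := is_derive_sinh y.
  by apply: is_derive_eq; rewrite /GRing.scale/=; lra.
by rewrite mulr_ge0// (le_trans y0)// le_sinh.
Qed.

Lemma sinh_gt0 x : 0 < x -> 0 < sinh x.
Proof. by move=> x0; rewrite (lt_le_trans x0)// le_sinh// ltW. Qed.

(* This is the tangent at [a] of the convex function s coth s, multiplied by
   sinh(a)^2 sinh(s). *)
Lemma tangent_mul_coth a s : 0 < a -> 0 < s ->
  a ^+ 2 * sinh s <=
  s * (sinh a * sinh (a - s) + a * sinh s).
Proof.
move=> a0 s0.
have sha := le_sinh (ltW a0); have shs := le_sinh (ltW s0).
(* After rearrangement the claim is s sinh(a) sinh(s - a) <= a (s - a) sinh(s). For s <= a it
   follows from sinh x >= x and from the growth of sinh(x) / x, which is [h2]. For s > a, sinh(s) is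
   expanded at a + (s - a) and tanh x <= x is applied to both a and s - a. *)
have [sa|as_] := leP s a.
  have h0 : 0 <= a - s by rewrite subr_ge0.
  have h1 := le_sinh h0.
  have h2 : a * sinh s <= s * sinh a.
    have -> : sinh a = sinh s * cosh (a - s) + cosh s * sinh (a - s).
      by rewrite -sinhD; congr sinh; lra.
    have h3 := sinh_le_mul_cosh (ltW s0).
    have h4 : 0 <= sinh s by exact: le_trans (ltW s0) shs.
    have d1 : 0 <= cosh (a - s) - 1 by rewrite subr_ge0 cosh_ge1.
    have d2 : 0 <= sinh (a - s) - (a - s) by rewrite subr_ge0.
    have d3 : 0 <= s * cosh s - sinh s by rewrite subr_ge0.
    have c0 : 0 <= cosh s := le_trans ler01 (cosh_ge1 s).
    have := mulr_ge0 (mulr_ge0 (ltW s0) h4) d1.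
    have := mulr_ge0 (mulr_ge0 (ltW s0) c0) d2.
    have := mulr_ge0 d3 h0.
    lra.
  have d1 : 0 <= s * sinh a - a * sinh s by rewrite subr_ge0.
  have d2 : 0 <= sinh (a - s) - (a - s) by rewrite subr_ge0.
  have := mulr_ge0 d1 h0.
  have := mulr_ge0 (mulr_ge0 (ltW s0) (le_trans (ltW a0) sha)) d2.
  lra.
have h0 : 0 <= s - a by rewrite subr_ge0 ltW.
have -> : sinh (a - s) = - sinh (s - a) by rewrite /sinh !opprB; lra.
have E : sinh s = sinh a * cosh (s - a) + cosh a * sinh (s - a).
  by rewrite -sinhD; congr sinh; lra.
have h1 := le_sinh h0.
have d1 : 0 <= (s - a) * cosh (s - a) - sinh (s - a).
  by rewrite subr_ge0 sinh_le_mul_cosh.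
have d2 : 0 <= a * cosh a - sinh a by rewrite subr_ge0 sinh_le_mul_cosh// ltW.
have := mulr_ge0 (mulr_ge0 (ltW a0) (le_trans (ltW a0) sha)) d1.
have := mulr_ge0 (mulr_ge0 h0 (le_trans h0 h1)) d2.
rewrite E; lra.
Qed.

(** * Polynomial and rational bounds on the logarithm *)

Lemma is_derive_ln1D x : -1 < x ->
  is_derive x 1 (fun y => ln (1 + y)) (1 + x)^-1.
Proof.
move=> x1; have x0 : 0 < 1 + x by lra.
have dl := is_derive1_ln x0.
by apply: is_derive_eq; rewrite /GRing.scale/=; lra.
Qed.

Lemma is_derive_ln1B x : x < 1 ->
  is_derive x 1 (fun y => ln (1 - y)) (- (1 - x)^-1).
Proof.
move=> x1; have x0 : 0 < 1 - x by lra.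
have dl := is_derive1_ln x0.
by apply: is_derive_eq; rewrite /GRing.scale/=; lra.
Qed.

Lemma ln_1D_div_1B e : 0 <= e < 1 ->
  ln ((1 + e) / (1 - e)) = ln (1 + e) - ln (1 - e).
Proof. by move=> e01; rewrite ln_div// posrE; lra. Qed.

(** Truncation of the series of 2 artanh(e), all of whose terms are nonnegative. *)
Lemma ln_1D_div_1B_ge e : 0 <= e < 1 ->
  2 * e + 2 / 3 * e ^+ 3 + 2 / 5 * e ^+ 5 <= ln ((1 + e) / (1 - e)).
Proof.
move=> e01; rewrite ln_1D_div_1B//.
pose f x := ln (1 + x) - ln (1 - x) -
  (2 * x + 2 / 3 * x ^+ 3 + 2 / 5 * x ^+ 5).
suff : f 0 <= f e.
  by rewrite /f addr0 subr0 subrr !expr0n/= !mulr0 !addr0 subr0 subr_ge0.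
apply: (@ge0_is_derive_le _ (fun x => 2 * x ^+ 6 / (1 - x ^+ 2))); first lra.
- move=> x xe; have d1 : is_derive x 1 (fun y => ln (1 + y)) (1 + x)^-1.
    by apply: is_derive_ln1D; lra.
  have d2 : is_derive x 1 (fun y => ln (1 - y)) (- (1 - x)^-1).
    by apply: is_derive_ln1B; lra.
  apply: is_derive_eq; rewrite /GRing.scale/=; field.
  by repeat (apply/andP; split); nra.
- move=> x xe; rewrite divr_ge0//; last by nra.
  by rewrite mulr_ge0// exprn_ge0//; lra.
Qed.

(** The last coefficient of the truncated series is raised from 2/5 to 8/15, for which the
    derivative of the difference stays nonnegative exactly up to 1/2. *)
Lemma ln_1D_div_1B_le e : 0 <= e <= 1 / 2 ->
  ln ((1 + e) / (1 - e)) <= 2 * e + 2 / 3 * e ^+ 3 + 8 / 15 * e ^+ 5.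
Proof.
move=> e01; rewrite ln_1D_div_1B; last lra.
pose f x := 2 * x + 2 / 3 * x ^+ 3 + 8 / 15 * x ^+ 5 -
  (ln (1 + x) - ln (1 - x)).
suff : f 0 <= f e.
  rewrite /f addr0 subr0 subrr !expr0n/= !mulr0 !addr0 subr0.
  by rewrite subr_ge0.
apply: (@ge0_is_derive_le _
  (fun x => 2 / 3 * x ^+ 4 * (1 - 4 * x ^+ 2) / (1 - x ^+ 2))); first lra.
- move=> x xe; have d1 : is_derive x 1 (fun y => ln (1 + y)) (1 + x)^-1.
    by apply: is_derive_ln1D; lra.
  have d2 : is_derive x 1 (fun y => ln (1 - y)) (- (1 - x)^-1).
    by apply: is_derive_ln1B; lra.
  apply: is_derive_eq; rewrite /GRing.scale/=; field.
  by repeat (apply/andP; split); nra.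
- move=> x xe; rewrite divr_ge0//; last by nra.
  by rewrite mulr_ge0 ?mulr_ge0 ?exprn_ge0//; nra.
Qed.

(** This is tanh s <= s at s = ln(x) / 2, since tanh(ln(x) / 2) = (x - 1) / (x + 1). *)
Lemma ln_ge_rational x : 1 <= x -> 2 * (x - 1) / (x + 1) <= ln x.
Proof.
move=> x1; have x0 : 0 < x + 1 by lra.
rewrite ler_pdivrMr//.
have := sinh_le_mul_cosh (_ : 0 <= ln x / 2).
rewrite divr_ge0 ?ln_ge0// => /(_ isT).
rewrite /sinh /cosh expRN.
have : expR (ln x / 2) ^+ 2 = x.
  by rewrite -expRM_natr divfK// lnK// posrE; lra.
have := expR_gt0 (ln x / 2).
set y := expR _ => y0 <-.
rewrite -[X in X <= _ -> _](_ : (y ^+ 2 - 1) / (2 * y) = _); last first.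
  by field; lra.
rewrite ler_pdivrMr; last lra.
have -> : ln (y ^+ 2) / 2 * ((y + y^-1) / 2) * (2 * y) =
   ln (y ^+ 2) / 2 * (y ^+ 2 + 1) by field; lra.
lra.
Qed.

Lemma ln_3_le : ln 3 <= 11 / 10 :> R.
Proof.
have h : 0 <= (1 / 2 : R) <= 1 / 2 by lra.
have := ln_1D_div_1B_le h.
have -> : (1 + 1 / 2) / (1 - 1 / 2) = 3 :> R by field.
lra.
Qed.

(** The tangent of ln at 3, which is the value of 1 + c at e = 1/2 in [chernoff_exponent_large]. *)
Lemma ln_le_div3 x : 0 < x -> ln x <= x / 3 + 1 / 10.
Proof.
move=> x0; have x30 : 0 < x / 3 by lra.
have := @le_ln1Dx R (x / 3 - 1) ltac:(lra).
have -> : 1 + (x / 3 - 1) = x / 3 by lra.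
by rewrite ln_div ?posrE//; have := ln_3_le; lra.
Qed.

(** * Choice of the tilt in the Chernoff exponent *)

(** The tilt makes 1 + [c] = (1 + e) / (1 - e), so that at the endpoint t = 1 - e the claim becomes
    2 e^2 <= ln ((1 + e^2) / (1 - e^2)). Smaller t are compared with this endpoint through
    [ln_ge_rational]. *)
Lemma chernoff_exponent_large e : 1 / 2 <= e < 1 ->
  exists2 c, 0 < c & forall t, 0 < t <= 1 - e ->
    2 * e ^+ 2 + ln (1 + c) <= (t + e) * ln (1 + c / t).
Proof.
move=> e1; have e'0 : 0 < 1 - e by lra.
pose c := 2 * e / (1 - e).
have e20 : 0 < 1 + e ^+ 2 by nra.
have Ec : 1 + c = (1 + e) / (1 - e) by rewrite /c; field; lra.
have c0 : 0 < c by rewrite divr_gt0//; lra.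
exists c => // t te.
(* The last comparison below is linear in x = c / t. [B] is the value of [A] (1 - e) that makes it
   an equality at the endpoint [x0]. *)
pose B := 2 * e / (1 + e ^+ 2).
pose A := 2 * e ^+ 2 + ln (1 + c).
have AB : A * (1 - e) <= B.
  have L : ln (1 + c) <= (1 + c) / 3 + 1 / 10 by apply: ln_le_div3; lra.
  rewrite ler_pdivlMr//.
  have -> : A * (1 - e) * (1 + e ^+ 2) = A * ((1 - e) * (1 + e ^+ 2)) by lra.
  apply: (@le_trans _ _ ((2 * e ^+ 2 + (1 + e) / (1 - e) / 3 + 1 / 10) *
      ((1 - e) * (1 + e ^+ 2)))).
    rewrite ler_pM2r; last by rewrite mulr_gt0.
    by rewrite -Ec /A; lra.
  rewrite -subr_ge0.
  have -> : 2 * e - (2 * e ^+ 2 + (1 + e) / (1 - e) / 3 + 1 / 10) *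
      ((1 - e) * (1 + e ^+ 2)) = 2 * e - (2 * e ^+ 2 + 1 / 10) *
      ((1 - e) * (1 + e ^+ 2)) - (1 + e) * (1 + e ^+ 2) / 3.
    by field; lra.
  (* The remaining polynomial in e is expanded at 1/2, where the signs of d (1 - d) and of the
     powers of [d] decide it. *)
  pose d := e - 1 / 2; have -> : e = d + 1 / 2 by rewrite /d; lra.
  have d0 : 0 <= d by rewrite /d; lra.
  have d1 : 0 <= 1 - d by rewrite /d; lra.
  have := mulr_ge0 d0 d1; have := exprn_ge0 3 d0.
  have := exprn_ge0 4 d0; have := exprn_ge0 5 d0.
  lra.
pose x0 := 2 * e / (1 - e) ^+ 2.
pose x := c / t.
have x00 : 0 < x0 by rewrite divr_gt0 ?exprn_gt0//; lra.
have xx0 : x0 <= x.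
  rewrite ler_pdivlMr; last lra.
  have -> : c = x0 * (1 - e) by rewrite /c /x0; field; lra.
  by rewrite ler_pM2l//; lra.
have A0 : A <= ln (1 + x0).
  have -> : 1 + x0 = (1 + c) * ((1 + e ^+ 2) / (1 - e ^+ 2)).
    by rewrite Ec /x0; field; apply/andP; split; nra.
  have e2 : 0 <= e ^+ 2 < 1 by nra.
  rewrite lnM ?posrE; [|lra|]; last by rewrite divr_gt0//; lra.
  rewrite /A addrC lerD2l (le_trans _ (ln_1D_div_1B_ge e2))//.
  have : 0 <= (e ^+ 2) ^+ 3 by rewrite exprn_ge0//; lra.
  have : 0 <= (e ^+ 2) ^+ 5 by rewrite exprn_ge0//; lra.
  lra.
have lnx : ln (1 + x) = ln (1 + x0) + ln ((1 + x) / (1 + x0)).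
  by rewrite ln_div ?posrE; lra.
have r1 : 1 <= (1 + x) / (1 + x0) by rewrite ler_pdivlMr; lra.
have := ln_ge_rational r1.
rewrite (_ : 2 * _ / _ = 2 * (x - x0) / (2 + x + x0)); last first.
  by field; repeat (apply/andP; split); lra.
set r := ln (_ / _) => hr.
have E : t + e = (c + e * x) / x by rewrite /x; field; apply/andP; split; lra.
have E' : 1 - (t + e) = (1 - e) * (x - x0) / x.
  by rewrite /x /x0 /c; field; repeat (apply/andP; split); lra.
rewrite -/x -/A lnx -/r.
have te0 : 0 <= t + e by lra.
suff : A * (1 - (t + e)) <= (t + e) * r.
  by have := ler_wpM2l te0 A0; lra.
apply: (@le_trans _ _ ((t + e) * (2 * (x - x0) / (2 + x + x0)))); last first.
  by rewrite ler_wpM2l//; lra.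
rewrite E' E.
have -> : A * ((1 - e) * (x - x0) / x) =
    (x - x0) * ((2 + x + x0) * (A * (1 - e))) / (x * (2 + x + x0)).
  by field; apply/andP; split; lra.
have -> : (c + e * x) / x * (2 * (x - x0) / (2 + x + x0)) =
    (x - x0) * (2 * (c + e * x)) / (x * (2 + x + x0)).
  by field; apply/andP; split; lra.
rewrite ler_pM2r; last by rewrite invr_gt0 mulr_gt0; lra.
rewrite ler_wpM2l ?subr_ge0//.
apply: (@le_trans _ _ ((2 + x + x0) * B)); first by rewrite ler_wpM2l//; lra.
have B1 : B <= 2 * e by rewrite /B ler_pdivrMr//; nra.
have B2 : B * (1 + x0) = x0 by rewrite /B /x0; field; apply/andP; split; lra.
have B3 : c + e * x0 = x0 by rewrite /c /x0; field; lra.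
have := ler_wpM2r (_ : 0 <= x - x0) B1; rewrite subr_ge0 => /(_ xx0).
lra.
Qed.

(* Writing the Chernoff tilt 1 + c / t as exp (2 s) turns
   (t + e) ln (1 + c / t) into s (c coth s - (c - 2 e)). *)
Lemma chernoff_exponent_sinh c e t : 0 < c -> 0 < t ->
  exists2 s, 0 < s & (t + e) * ln (1 + c / t) * sinh s =
    s * (c * cosh s - (c - 2 * e) * sinh s).
Proof.
move=> c0 t0; have ct0 : 0 < c / t by rewrite divr_gt0.
pose s := ln (1 + c / t) / 2.
exists s; first by rewrite divr_gt0 ?ln_gt0//; lra.
have -> : ln (1 + c / t) = 2 * s by rewrite /s; lra.
have : expR s ^+ 2 = 1 + c / t.
  by rewrite -expRM_natr divfK// lnK// posrE; lra.
rewrite /sinh /cosh expRN; have := expR_gt0 s; set v := expR s => v0 Ev.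
have -> : c = t * (v ^+ 2 - 1) by rewrite Ev; field; lra.
by field; lra.
Qed.

(** The quadratic is concave in t because 2 e - 1 <= 0, so it suffices to check both ends of the
    interval. There all terms below e^6 cancel, which is why the logarithm is bounded up to order
    5. *)
Lemma small_exponent_quadratic_ge0 e t : 0 < e <= 1 / 2 ->
  2 * e + 2 / 3 * e ^+ 3 + 2 / 5 * e ^+ 5 <= t ->
  t <= 2 * e + 2 / 3 * e ^+ 3 + 8 / 15 * e ^+ 5 ->
  0 <= t ^+ 2 * (2 * e - 1) * (1 - e) * (1 + e) ^+ 2 +
    t * (1 - e) * (2 * e * (2 + e) - 2 * e ^+ 2 * (1 + e) ^+ 2) +
    4 * e ^+ 3 * (1 - e) - 4 * e ^+ 2.
Proof.
move=> e01; set lo := (X in X <= t -> _); set hi := (X in t <= X -> _).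
move=> tlo thi.
pose Q x := x ^+ 2 * (2 * e - 1) * (1 - e) * (1 + e) ^+ 2 +
    x * (1 - e) * (2 * e * (2 + e) - 2 * e ^+ 2 * (1 + e) ^+ 2) +
    4 * e ^+ 3 * (1 - e) - 4 * e ^+ 2.
rewrite -/(Q t).
have e0 : 0 < e by lra.
have ek k : e ^+ k <= (1 / 2) ^+ k by rewrite lerXn2r ?nnegrE//; lra.
have e6 : 0 <= e ^+ 6 by rewrite exprn_ge0// ltW.
have e5 : 0 < e ^+ 5 by rewrite exprn_gt0.
have Qlo : 0 <= Q lo.
  have -> : Q lo = e ^+ 6 * (8 / 9 - 8 / 9 * e - 32 / 45 * e ^+ 3 -
     416 / 225 * e ^+ 4 - 28 / 75 * e ^+ 5 - 44 / 75 * e ^+ 6 -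
     4 / 25 * e ^+ 7 - 8 / 25 * e ^+ 8) by rewrite /Q /lo; field.
  apply: mulr_ge0; first exact: e6.
  have := ek 3; have := ek 4; have := ek 5; have := ek 6; have := ek 7.
  have := ek 8; lra.
have Qhi : 0 <= Q hi.
  have -> : Q hi = e ^+ 6 * (8 / 9 - 8 / 9 * e + 8 / 9 * e ^+ 2 -
     4 / 5 * e ^+ 3 - 56 / 25 * e ^+ 4 - 32 / 75 * e ^+ 5 -
     128 / 225 * e ^+ 6 - 64 / 225 * e ^+ 7 - 128 / 225 * e ^+ 8).
    by rewrite /Q /hi; field.
  apply: mulr_ge0; first exact: e6.
  have := ek 3; have := ek 4; have := ek 5; have := ek 6; have := ek 7.
  have := ek 8; have := sqr_ge0 e; lra.
have lohi : 0 < hi - lo by rewrite /hi /lo; lra.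
rewrite -(pmulr_rge0 _ lohi).
have -> : (hi - lo) * Q t = (t - lo) * Q hi + (hi - t) * Q lo +
    (1 - 2 * e) * (1 - e) * (1 + e) ^+ 2 * ((t - lo) * (hi - t) * (hi - lo)).
  by rewrite /Q; ring.
have d1 : 0 <= t - lo by rewrite subr_ge0.
have d2 : 0 <= hi - t by rewrite subr_ge0.
by rewrite !addr_ge0 ?mulr_ge0 ?exprn_ge0//; lra.
Qed.

(* The bound is tightest near t = (1 - e) / 2, where the optimal Chernoff tilt
   is ((1 + e) / (1 - e))^2 = exp (2 T): [c] is chosen so that the minimum over s
   of s (c coth s - (c - 2 e)) is attained at s = T. *)
Lemma chernoff_exponent_small e : 0 < e <= 1 / 2 ->
  exists2 c, 0 < c & forall t, 0 < t <= 1 - e ->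
    2 * e ^+ 2 + ln (1 + c) <= (t + e) * ln (1 + c / t).
Proof.
move=> e1; have e0 : 0 < e by lra.
have e01 : 0 <= e < 1 by lra.
have e012 : 0 <= e <= 1 / 2 by lra.
have e'0 : 1 - e != 0 by lra.
have e''0 : 1 + e != 0 by lra.
pose y := (1 + e) / (1 - e); pose T := ln y.
have y0 : 0 < y by rewrite divr_gt0; lra.
have := ln_1D_div_1B_ge e01; have := ln_1D_div_1B_le e012; rewrite -/y -/T.
move=> Thi Tlo.
have e3 : 0 < e ^+ 3 by rewrite exprn_gt0.
have e5 : 0 < e ^+ 5 by rewrite exprn_gt0.
have T2 : 2 * e <= T by lra.
have T0 : 0 < T by lra.
have e2 : 0 < 1 - e ^+ 2 by nra.
have shT : sinh T = 2 * e / (1 - e ^+ 2).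
  by rewrite /sinh expRN lnK ?posrE// /y; field; lra.
have chT : cosh T = (1 + e ^+ 2) / (1 - e ^+ 2).
  by rewrite /cosh expRN lnK ?posrE// /y; field; lra.
(* For b = (cosh T sinh T - T) / sinh(T)^2, the function s (coth s - b) is stationary at [T], with
   value [kappa]. Matching c b with c - 2 e gives c = 2 e / (1 - b), and [g] is 1 - b. *)
pose kappa := T ^+ 2 / sinh T ^+ 2.
pose g := 1 - (cosh T * sinh T - T) / sinh T ^+ 2.
have Ek : kappa = T ^+ 2 * (1 - e ^+ 2) ^+ 2 / (4 * e ^+ 2).
  by rewrite /kappa shT; field; lra.
have Eg : g = T * (1 - e ^+ 2) ^+ 2 / (4 * e ^+ 2) - (1 - e) ^+ 2 / (2 * e).
  by rewrite /g shT chT; field; lra.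
have g0 : 0 < g.
  have -> : g = (1 - e) ^+ 2 * ((1 + e) ^+ 2 * T - 2 * e) / (4 * e ^+ 2).
    by rewrite Eg; field; lra.
  have h1 : 0 < (1 - e) ^+ 2 by rewrite exprn_gt0//; lra.
  have h2 : 0 < (1 + e) ^+ 2 * T - 2 * e.
    have := mulr_gt0 e0 T0; have := mulr_gt0 e0 (mulr_gt0 e0 T0); lra.
  have h3 : 0 < 4 * e ^+ 2 by nra.
  exact: divr_gt0 (mulr_gt0 h1 h2) h3.
pose c := 2 * e / g.
have c0 : 0 < c by rewrite divr_gt0//; lra.
exists c => // t te; have t0 : 0 < t by lra.
have kc : 2 * e ^+ 2 + ln (1 + c) <= c * kappa.
  (* The tangent of ln at [y]. Multiplied by [g], the claim then becomes, up to a positive factor,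
     the quadratic inequality in [T] of [small_exponent_quadratic_ge0]. *)
  have lnc : ln (1 + c) <= T + ((1 + c) / y - 1).
    have h : 0 < (1 + c) / y by rewrite divr_gt0//; lra.
    have := @le_ln1Dx R ((1 + c) / y - 1) ltac:(lra).
    have -> : 1 + ((1 + c) / y - 1) = (1 + c) / y by lra.
    by rewrite ln_div ?posrE//; [rewrite -/T; lra | lra].
  apply: (le_trans (lerD (lexx _) lnc)).
  rewrite -subr_ge0 -(pmulr_rge0 _ g0).
  have -> : g * (c * kappa - (2 * e ^+ 2 + (T + ((1 + c) / y - 1)))) =
      2 * e * kappa - g * (2 * e ^+ 2 + T) -
      ((g + 2 * e) * (1 - e) / (1 + e) - g).
    by rewrite /c /y; field; lra.
  rewrite Ek Eg [X in 0 <= X](_ : _ = (1 - e) / (4 * e ^+ 2) *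
      (T ^+ 2 * (2 * e - 1) * (1 - e) * (1 + e) ^+ 2 +
      T * (1 - e) * (2 * e * (2 + e) - 2 * e ^+ 2 * (1 + e) ^+ 2) +
      4 * e ^+ 3 * (1 - e) - 4 * e ^+ 2)); last by field; lra.
  apply: mulr_ge0; last exact: small_exponent_quadratic_ge0.
  by rewrite divr_ge0 ?mulr_ge0 ?exprn_ge0//; lra.
apply: (le_trans kc).
have [s s0 Es] := chernoff_exponent_sinh e c0 t0.
have shs : 0 < sinh s by exact: sinh_gt0.
have shT0 : 0 < sinh T by exact: sinh_gt0.
rewrite -(ler_pM2r shs) Es.
have Ec : c - 2 * e = c * ((cosh T * sinh T - T) / sinh T ^+ 2).
  have -> : 2 * e = c * g by rewrite /c; field; lra.
  by rewrite /g; lra.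
rewrite Ec; set b := _ / sinh T ^+ 2.
have -> : s * (c * cosh s - c * b * sinh s) = c * (s * (cosh s - b * sinh s)).
  by ring.
rewrite -mulrA ler_pM2l// /kappa /b.
have sh2 : 0 < sinh T ^+ 2 by rewrite exprn_gt0.
rewrite mulrAC ler_pdivrMr// (le_trans (tangent_mul_coth T0 s0))//.
rewrite sinhB le_eqVlt; apply/orP; left; apply/eqP; field; lra.
Qed.

Lemma chernoff_exponent e : 0 < e < 1 ->
  exists2 c, 0 < c & forall t, 0 < t <= 1 - e ->
    2 * e ^+ 2 + ln (1 + c) <= (t + e) * ln (1 + c / t).
Proof.
move=> e01; have [|] := leP e (1 / 2) => he.
  by apply: chernoff_exponent_small; lra.
by apply: chernoff_exponent_large; lra.
Qed.

End real_inequalities.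

(** * Ville's inequality for the counts of an independent sample in nested sets *)

Section boundary_crossing.
Context d (T : measurableType d) (R : realType) (P : probability T R) (n : nat).
Variables (X : 'I_n -> {RV P >-> R}) (mu : set R -> R).
Hypothesis X_indep : mutually_independent X.
Hypothesis X_mu : forall i A, measurable A -> P (X i @^-1` A) = (mu A)%:E.

Let rect (A : 'I_n -> set R) : set T :=
  \bigcap_(i in [set` [set: 'I_n]%SET]) X i @^-1` A i.

Let measurable_rect A : (forall i, measurable (A i)) -> measurable (rect A).
Proof.
move=> mA; apply: fin_bigcap_measurable => [|i _]; first exact: finite_finset.
by rewrite -[X in measurable X]setTI; exact: measurable_funP.
Qed.

Let P_rect A : (forall i, measurable (A i)) ->
  P (rect A) = (\prod_i mu (A i))%:E.
Proof.
move=> mA; rewrite X_indep//.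
rewrite -prodEFin; apply: eq_big => [i|i _]; first by rewrite inE.
by rewrite X_mu.
Qed.

Hypothesis n_gt0 : (0 < n)%N.

Let mu_ge0 A : measurable A -> 0 <= mu A.
Proof. by move=> mA; rewrite -lee_fin -(X_mu (Ordinal n_gt0) mA). Qed.

Let muD A B : measurable A -> measurable B -> A `<=` B ->
  mu (B `\` A) = mu B - mu A.
Proof.
move=> mA mB AB; apply: EFin_inj.
pose i := Ordinal n_gt0.
have mX C : measurable C -> measurable (X i @^-1` C).
  by move=> mC; rewrite -[X in measurable X]setTI; exact: measurable_funP.
rewrite EFinB -!(X_mu i)//; last exact: measurableD.
rewrite (_ : X i @^-1` (B `\` A) = X i @^-1` B `\` X i @^-1` A)//.
rewrite measureD//; [|exact: mX|exact: mX|].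
  rewrite (_ : X i @^-1` B `&` X i @^-1` A = X i @^-1` A)//.
  by rewrite setIidr// => w /AB.
by rewrite ltey_eq fin_num_measure//; exact: mX.
Qed.

Variables (B : nat -> set R) (K : nat -> nat) (N : nat) (c C : R).
Hypothesis mB : forall l, measurable (B l).
Hypothesis B_nested : forall l, B l `<=` B l.+1.
Hypothesis c_ge0 : 0 <= c.
Hypothesis C_gt0 : 0 < C.
(** At a crossing the martingale (1 + c / mu (B l))^N_l is at least [C]. The denominator is cleared
    so that mu (B l) = 0 is allowed. *)
Hypothesis KC : forall l, (l < N)%N ->
  C * mu (B l) ^+ K l <= (mu (B l) + c) ^+ K l.

(** In the induction [J] holds the points that are still in the current lower set; a point that has
    left it lies in no smaller set and is not counted again. *)
Let crossing m (J : {set 'I_n}) : set T :=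
  [set w | exists2 l, (l < m)%N &
    (K l <= #|[set j in J | `[< B l (X j w) >] ]%SET|)%N].

Let B_le l m : (l <= m)%N -> B l `<=` B m.
Proof.
elim: m => [|m IH]; first by rewrite leqn0 => /eqP ->.
rewrite leq_eqVlt => /predU1P[->//|/IH]; rewrite -/(B m) => h x /h.
exact: B_nested.
Qed.

(* Discrete form of Ville's inequality, by induction on the number of
   thresholds. Condition on the set J' of the points of J that lie in the next
   lower set [B m]: either the crossing occurs at [B m] already, or the
   induction hypothesis applies to J'. Summing over J' gives back the product by
   distributivity. Exhibiting a measurable superset [M] spares the
   measurability of the event itself. *)
Lemma crossing_bound m (J : {set 'I_n}) (A : 'I_n -> set R) :
  (m <= N)%N ->
  (forall i, measurable (A i)) -> (forall i, i \in J -> A i = B m) ->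
  exists M : set T, [/\ measurable M, rect A `&` crossing m J `<=` M &
    (P M <= (\prod_i (if i \in J then mu (B m) + c else mu (A i)) / C)%:E)%E].
Proof.
elim: m J A => [|m IH] J A mN mA AJ.
  exists set0; split => //; first by move=> w [_ []].
  rewrite measure0 lee_fin divr_ge0 ?(ltW C_gt0)// prodr_ge0// => i _.
  by case: ifP => _; rewrite ?addr_ge0 ?mu_ge0.
pose A' (J' : {set 'I_n}) i :=
  if i \in J' then B m else if i \in J then B m.+1 `\` B m else A i.
have mA' J' i : measurable (A' J' i).
  by rewrite /A'; case: ifP => // _; case: ifP => // _; exact: measurableD.
have muB : 0 <= mu (B m.+1) - mu (B m).
  by rewrite -muD// mu_ge0//; exact: measurableD.
(* The factor 0 for i in J' but not in J lets the sum run over all J', as [bigA_distr] needs; for i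
   in J the two choices add up to mu (B m.+1) + c. *)
pose bound (J' : {set 'I_n}) := \prod_i (if i \in J' then
    if i \in J then mu (B m) + c else 0
  else if i \in J then mu (B m.+1) - mu (B m) else mu (A i)) / C.
have bound_ge0 J' : 0 <= bound J'.
  rewrite divr_ge0 ?(ltW C_gt0)// prodr_ge0// => i _.
  by case: ifP => _; case: ifP => _ //;
    [rewrite addr_ge0 ?mu_ge0|exact: mu_ge0].
have mu_A' (J' : {set 'I_n}) i : mu (A' J' i) = if i \in J' then mu (B m) else
    if i \in J then mu (B m.+1) - mu (B m) else mu (A i).
  by rewrite /A'; case: ifP => // _; case: ifP => // _; exact: muD.
have exM (J' : {set 'I_n}) : J' \subset J -> exists M : set T, [/\ measurable M,
    (K m <= #|J'|)%N -> rect (A' J') `<=` M,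
    rect (A' J') `&` crossing m J' `<=` M & (P M <= (bound J')%:E)%E].
  move=> J'J; have J'iJ i : i \in J' -> i \in J by apply/fintype.subsetP.
  have [KJ'|J'K] := leqP (K m) #|J'|; last first.
    have [|M [mM EM PM]] := IH J' (A' J') (ltnW mN) (mA' J').
      by move=> i; rewrite /A' => ->.
    exists M; split => //.
    apply: (le_trans PM); rewrite lee_fin /bound.
    rewrite ler_pM2r ?invr_gt0// le_eqVlt; apply/orP; left; apply/eqP.
    apply: eq_bigr => i _; rewrite mu_A'.
    by have [/J'iJ ->|] := boolP (i \in J').
  exists (rect (A' J')); split;
    [exact: measurable_rect|by move=> _ w|by move=> w []|].
  rewrite P_rect// lee_fin /bound ler_pdivlMr//.
  under eq_bigr => i _ do rewrite mu_A'.
  rewrite (bigID (mem J'))/= [leRHS](bigID (mem J'))/=.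
  rewrite [X in _ <= _ * X](eq_bigr (fun i => if i \in J' then mu (B m) else
    if i \in J then mu (B m.+1) - mu (B m) else mu (A i))); last first.
    by move=> i /negbTE ->.
  rewrite mulrAC ler_wpM2r//.
    by apply: prodr_ge0 => i /negbTE ->; case: ifP => _ //; exact: mu_ge0.
  rewrite (eq_bigr (fun=> mu (B m))); last by move=> i ->.
  rewrite [leRHS](eq_bigr (fun=> mu (B m) + c)); last first.
    by move=> i iJ'; rewrite iJ' (J'iJ _ iJ').
  (* Of the #|J'| equal factors, [K m] are handled together by [KC], which absorbs [C]; the others
     only grow when c is added. *)
  rewrite !prodr_const -(subnKC KJ') !exprD mulrC mulrA.
  apply: ler_pM => //; first by rewrite mulr_ge0 ?exprn_ge0 ?mu_ge0// ltW.
  - by rewrite exprn_ge0 ?mu_ge0.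
  - exact: KC.
  - by rewrite lerXn2r ?nnegrE ?addr_ge0 ?mu_ge0// lerDl.
have /choice[M M_] : forall J' : {set 'I_n}, exists M : set T, J' \subset J ->
    [/\ measurable M, (K m <= #|J'|)%N -> rect (A' J') `<=` M,
    rect (A' J') `&` crossing m J' `<=` M & (P M <= (bound J')%:E)%E].
  move=> J'; have [J'J|_] := boolP (J' \subset J); last by exists set0.
  by have [M HM] := exM _ J'J; exists M.
exists (\big[setU/set0]_(J' : {set 'I_n} | J' \subset J) M J'); split.
- by apply: bigsetU_measurable => J' /M_[].
- move=> w [wA [l lm Kl]].
  pose J' := [set j in J | `[< B m (X j w) >] ]%SET.
  have J'J : J' \subset J by apply/fintype.subsetP => j; rewrite inE => /andP[].
  have wA' : rect (A' J') w.
    move=> i _ /=; rewrite /A' inE.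
    have := wA i; rewrite /= inE => /(_ isT) wAi.
    have [iJ|//] := boolP (i \in J) => /=.
    case: asboolP => // nB; split => //.
    by rewrite -(AJ i).
  have [_ M1 M2 _] := M_ J' J'J.
  rewrite (bigD1 J')//=; left.
  move: lm; rewrite ltnS leq_eqVlt => /predU1P[lm|lm].
    by move: Kl; rewrite lm => Kl; exact: (M1 Kl w wA').
  apply: M2; split => //; exists l => //; apply: (leq_trans Kl).
  apply: subset_leq_card; apply/fintype.subsetP => j.
  rewrite !inE => /andP[-> /asboolP Bl] /=.
  by apply/andP; split; apply/asboolP => //; exact: (B_le (ltnW lm) Bl).
- apply: (@le_trans _ _ (\sum_(J' : {set 'I_n} | J' \subset J) bound J')%:E).
    rewrite -sumEFin.
    pose U := \big[setU/set0]_(J' : {set 'I_n} | J' \subset J) M J'.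
    rewrite -/U.
    suff [] : measurable U /\ (P U <=
       \sum_(J' : {set 'I_n} | J' \subset J) (bound J')%:E)%E by [].
    apply: (big_rec2 (fun (V : set T) x => measurable V /\ (P V <= x)%E)).
      by split => //; rewrite measure0.
    move=> J' V x /M_[mM _ _ PM] [mV PV]; split; first exact: measurableU.
    by apply: (le_trans (measureU2 _ _ _)) => //; exact: leeD.
  rewrite lee_fin.
  apply: (@le_trans _ _ (\sum_(J' : {set 'I_n}) bound J')).
    by rewrite big_mkcond/= ler_sum// => J' _; case: ifP.
  rewrite -mulr_suml ler_pM2r ?invr_gt0// -bigA_distr ler_prod// => i _.
  case: ifP => iJ /=; last by rewrite add0r lexx mu_ge0.
  have -> : mu (B m) + c + (mu (B m.+1) - mu (B m)) = mu (B m.+1) + c by ring.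
  by rewrite lexx addr_ge0 ?mu_ge0.
Qed.

(** The martingale starts at the whole space, where every point is counted and mu is 1; hence the
    initial value (1 + c)^n. *)
Lemma crossing_bound_setT : B N = setT ->
  exists M : set T, [/\ measurable M,
    [set w | exists2 l, (l < N)%N &
      (K l <= #|[pred i | `[< B l (X i w) >]]|)%N] `<=` M &
    (P M <= ((1 + c) ^+ n / C)%:E)%E].
Proof.
move=> BN; have [|i _|M [mM EM PM]] :=
  @crossing_bound N [set: 'I_n]%SET (fun=> B N) (leqnn N); [by []|by []|].
exists M; split => //.
  move=> w [l lN Kl]; apply: EM; split.
    by move=> i _ /=; rewrite BN.
  exists l => //; apply: (leq_trans Kl); apply: subset_leq_card.
  by apply/fintype.subsetP => i; rewrite !inE.
apply: (le_trans PM); rewrite lee_fin ler_pM2r ?invr_gt0//.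
under eq_bigr do rewrite inE.
have -> : mu (B N) = 1.
  apply: EFin_inj; rewrite -(X_mu (Ordinal n_gt0))// BN preimage_setT.
  exact: probability_setT.
by rewrite prodr_const card_ord.
Qed.

End boundary_crossing.


(** * The one-sided Dvoretzky-Kiefer-Wolfowitz inequality for uniform samples *)

Lemma uniform_prob_lt (R : realType) (b : R) : 0 <= b <= 1 ->
  uniform_prob (@ltr01 R) `]-oo, b[ = b%:E.
Proof.
move=> /andP[b0 b1]; rewrite /uniform_prob integral_uniform_pdf.
rewrite (_ : `]-oo, b[ `&` `[0, 1] = `[0, b[%classic); last first.
  apply/seteqP; split=> x /=; rewrite !in_itv/=.
    by case=> xb /andP[x0 _]; rewrite x0.
  by move=> /andP[x0 xb]; rewrite xb x0 (le_trans (ltW xb)).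
rewrite (eq_integral (cst 1%E)); last first.
  move=> x; rewrite inE/= in_itv/= => /andP[x0 xb].
  by rewrite /uniform_pdf x0 (le_trans (ltW xb))//= subr0 invr1.
rewrite integral_cst//= mul1e lebesgue_measure_itv/= lte_fin.
case: ltP => [_|]; first by rewrite oppr0 adde0.
by move=> b0'; congr EFin; apply/eqP; rewrite eq_le b0 b0'.
Qed.

Section uniform_sample_tail.
Context d (T : measurableType d) (R : realType) (P : probability T R) (n : nat).
Variable X : 'I_n -> {RV P >-> R}.
Hypothesis n_gt0 : (0 < n)%N.
Hypothesis X_uniform : uniform_sample X.

(* For [1 <= e] the thresholds vanish and [delta] can be any positive number. *)
Lemma order_statistics_dkw (e delta : R) : 0 < e -> 0 < delta ->
  (e < 1 -> expR (- (2 * n%:R * e ^+ 2)) <= delta) ->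
  exists M : set T, [/\ measurable M,
    [set w | exists k : 'I_n, tnth (order_statistics (X ^~ w)) k <
      Num.max 0 (k.+1%:R / n%:R - e)] `<=` M & (P M <= delta%:E)%E].
Proof.
move=> e0 delta0 edelta; case: X_uniform => X_indep X_unif.
have n0 : 0 < n%:R :> R by rewrite ltr0n.
pose mu (A : set R) := fine (uniform_prob (@ltr01 R) A).
have X_mu i A : measurable A -> P (X i @^-1` A) = (mu A)%:E.
  by move=> mA; rewrite /mu fineK ?fin_num_measure// -(X_unif i).
pose b l : R := Num.max 0 (l.+1%:R / n%:R - e).
have b_ge0 l : 0 <= b l by rewrite le_max lexx.
(* The thresholds are indexed by l < n; the whole line at index n serves as the starting set of the
   martingale. *)
pose B l : set R := if (l < n)%N then `]-oo, b l[%classic else setT.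
have mB l : measurable (B l) by rewrite /B; case: ifP.
have b_le l l' : (l <= l')%N -> b l <= b l'.
  move=> ll'; rewrite /b ge_max !le_max lexx/=; apply/orP; right.
  by rewrite lerD2r ler_pM2r ?invr_gt0// ler_nat.
have B_nested l : B l `<=` B l.+1.
  rewrite /B; case: (ltnP l.+1 n) => // ln; rewrite (ltnW ln) => x /=.
  by rewrite !in_itv/= => xb; exact: lt_le_trans xb (b_le _ _ (leqnSn l)).
have b_lt l : (l < n)%N -> b l <= 1.
  move=> ln; rewrite /b ge_max ler01/= lerBlDr (@le_trans _ _ 1)//.
    by rewrite ler_pdivrMr// mul1r ler_nat.
  by rewrite lerDl ltW.
have mu_B l : (l < n)%N -> mu (B l) = b l.
  by move=> ln; rewrite /mu /B ln uniform_prob_lt// b_ge0 b_lt.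
(* The level C = (1 + c)^n / delta is chosen so that the crossing bound (1 + c)^n / C equals
   [delta]. *)
have [c c0 KC] : exists2 c, 0 < c & forall l, (l < n)%N ->
    (1 + c) ^+ n / delta * b l ^+ l.+1 <= (b l + c) ^+ l.+1.
  have trivial_bound c l : 0 < c -> l.+1%:R / n%:R - e <= 0 ->
      (1 + c) ^+ n / delta * b l ^+ l.+1 <= (b l + c) ^+ l.+1.
    move=> c0 le; rewrite /b (max_l le) expr0n/= mulr0 exprn_ge0//.
    by rewrite add0r ltW.
  have [e1|e1] := leP 1 e.
    exists 1 => // l ln; apply: trivial_bound => //.
    rewrite subr_le0 (le_trans _ e1)// ler_pdivrMr// mul1r ler_nat//.
  have [|c c0 Hc] := @chernoff_exponent _ e; first by rewrite e0.
  exists c => // l l_lt_n; have [le|lt] := leP (l.+1%:R / n%:R - e) 0.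
    exact: trivial_bound.
  set t := l.+1%:R / n%:R - e in lt.
  have -> : b l = t by rewrite /b max_r// ltW.
  have tc : 0 < 1 + c / t by rewrite addr_gt0// divr_gt0.
  have -> : t + c = t * (1 + c / t) by rewrite mulrDr mulr1 mulrC divfK ?gt_eqF.
  rewrite exprMn mulrC ler_pM2l ?exprn_gt0//.
  have c1 : 0 < 1 + c by rewrite addr_gt0.
  rewrite -ler_ln ?posrE ?divr_gt0 ?exprn_gt0//.
  rewrite ln_div ?posrE ?exprn_gt0// !lnXn//.
  have {}edelta : - (2 * n%:R * e ^+ 2) <= ln delta.
    by rewrite -[leLHS]expRK ler_ln ?posrE ?expR_gt0// edelta.
  have : 0 < t <= 1 - e.
    rewrite lt/= /t lerD2r ler_pdivrMr// mul1r ler_nat//.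
  move=> /Hc; rewrite -(ler_pM2l n0).
  (* As t + e = (l + 1) / n, multiplying the exponent inequality by n produces the count l + 1. *)
  have -> : n%:R * ((t + e) * ln (1 + c / t)) = ln (1 + c / t) *+ l.+1.
    by rewrite /t subrK mulrA mulrCA mulfV ?gt_eqF// mulr1 mulr_natl.
  by apply: le_trans; rewrite -mulr_natl; lra.
have C0 : 0 < (1 + c) ^+ n / delta by rewrite divr_gt0// exprn_gt0// addr_gt0.
have KCB l : (l < n)%N ->
    (1 + c) ^+ n / delta * mu (B l) ^+ l.+1 <= (mu (B l) + c) ^+ l.+1.
  by move=> ln; rewrite mu_B//; exact: KC.
have [|M [mM EM PM]] := crossing_bound_setT X_indep X_mu n_gt0 mB B_nested
  (ltW c0) C0 KCB; first by rewrite /B ltnn.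
exists M; split => //.
  move=> w [k Uk]; apply: EM; exists (k : nat) => //.
  (* At least k + 1 sample points are at most the order statistic of index [k], hence strictly below
     [b k]. *)
  have := order_statistics_le (X ^~ w) k (tnth (order_statistics (X ^~ w)) k).
  rewrite lexx => /esym kU; apply: (leq_trans kU); apply: subset_leq_card.
  apply/fintype.subsetP => i; rewrite !inE => Xi.
  by rewrite /B ltn_ord/= in_itv/= /b; exact: (le_lt_trans Xi Uk).
apply: (le_trans PM); rewrite lee_fin invf_div mulrCA mulfV ?mulr1//.
by rewrite gt_eqF// exprn_gt0// addr_gt0.
Qed.

(** * From the bound on order statistics to the quantile *)

(** Since z increases, m(z, .) is antitone: outside M the sample value is at most m(z, u), so the
    cdf there is at least 1 - delta. Taking delta > 0 and letting it decrease to alpha covers alpha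
    = 0, where no positive level equals alpha. *)
Lemma m_alpha_le (alpha : R) (z u : n.-tuple R) : 0 <= alpha ->
  (forall i : 'I_n, nth 1 z i <= nth 1 z i.+1) ->
  (forall delta, 0 < delta -> alpha <= delta -> exists M : set T,
    [/\ measurable M,
    [set w | exists k, tnth (order_statistics (X ^~ w)) k < tnth u k] `<=` M &
    (P M <= delta%:E)%E]) ->
  (m_alpha X alpha z <= (m_fun z u)%:E)%E.
Proof.
move=> alpha0 z_le tail; apply: ereal_inf_lbound; exists (m_fun z u) => //=.
pose Y : {RV P >-> R} := m_sample z X.
rewrite -/Y /cdf /distribution /pushforward.
have mY : measurable (Y @^-1` `]-oo, m_fun z u]).
  by rewrite -[X in measurable X]setTI; exact: measurable_funP.
have PY delta : 0 < delta -> alpha <= delta ->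
    ((1 - delta)%:E <= P (Y @^-1` `]-oo, m_fun z u]))%E.
  move=> delta0 alpha_delta; have [M [mM EM PM]] := tail _ delta0 alpha_delta.
  apply: (@le_trans _ _ (P (~` M))).
    by rewrite probability_setC// EFinB leeB.
  apply: le_measure; rewrite ?inE//; first exact: measurableC.
  move=> w Mw; rewrite /= in_itv/= /Y /m_sample /m_fun lerD2l lerN2.
  apply: ler_sum => i _; rewrite ler_wpM2r// ?subr_ge0//.
  by rewrite leNgt; apply/negP => Ui; apply: Mw; apply: EM; exists i.
apply/lee_addgt0Pr => r r0.
have -> : 1 - alpha = 1 - (alpha + r) + r by lra.
by rewrite EFinD leeD2r// PY; lra.
Qed.

End uniform_sample_tail.

Theorem theorem1 (R : realType) (n : nat) (hn : (1 <= n)%N)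
    (d : measure_display) (T : measurableType d) (P : probability T R)
    (X : 'I_n -> {RV P >-> R}) (hX : uniform_sample X)
    (z : n.-tuple R) (z_sorted : sorted <=%R z)
    (z_range : forall i : 'I_n, 0 <= tnth z i <= 1)
    (alpha : R) (halpha : 0 <= alpha <= 1 / 2) :
  (m_alpha X alpha z <= (m_Anderson alpha z)%:E)%E.
Proof.
case/andP: halpha => alpha0 alpha1.
have n0 : 0 < n%:R :> R by rewrite ltr0n.
apply: m_alpha_le => [//|i|delta delta0 alpha_delta].
  (* At the last index the successor is the default value z_(n+1) = 1, and the range of z gives the
     inequality. *)
  have [ni|ni] := ltnP i.+1 n; last first.
    rewrite [leRHS]nth_default ?size_tuple//.
    by rewrite -(tnth_nth 1); have /andP[] := z_range i.
  by apply: (sortedP 1 z_sorted); rewrite size_tuple.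
have [a0|a0] := eqVneq alpha 0.
  (* With e = 1 the premise on [delta] is vacuous, and the thresholds are still at least u^DKW =
     0. *)
  have [|M [mM EM PM]] := order_statistics_dkw hn hX ltr01 delta0.
    by rewrite ltxx.
  exists M; split => // w [k Uk]; apply: EM; exists k.
  apply: (lt_le_trans Uk).
  by rewrite tnth_mktuple a0 eqxx le_max lexx.
have {}alpha0 : 0 < alpha by rewrite lt_def a0.
have ln0 : 0 < ln (1 / alpha) by rewrite ln_gt0// ltr_pdivlMr//; lra.
have e0 : 0 < ln (1 / alpha) / (2 * n%:R) by rewrite divr_gt0// mulr_gt0.
have s0 : 0 < Num.sqrt (ln (1 / alpha) / (2 * n%:R)) by rewrite sqrtr_gt0.
(* For this radius e, exp (- 2 n e^2) is exactly [alpha]. *)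
have [|M [mM EM PM]] := order_statistics_dkw hn hX s0 delta0.
  move=> _; rewrite sqr_sqrtr ?(ltW e0)//.
  rewrite mulrC divfK; last by rewrite gt_eqF// mulr_gt0.
  by rewrite div1r lnV ?posrE// opprK lnK ?posrE.
exists M; split => // w [k Uk]; apply: EM; exists k.
by move: Uk; rewrite tnth_mktuple (negbTE a0).
Qed.
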